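(* Let $S$ be a densely defined, closed, symmetric operator in a Hilbert space $\mathcal H$ and let $\{\mathcal G,\Gamma_0,\Gamma_1\}$ be a quasi boundary triple for $T\subset S^*$ with $\gamma$-field $\gamma$ and Weyl function $M$. Let $B$ be a closable operator in $\mathcal G$ and assume that there exists $\lambda_0\in\rho(A_0)$ such that (i) $1\in\rho\bigl(B\,\overline{M(\lambda_0)}\bigr)$; (ii) $B\bigl(\operatorname{ran}\overline{M(\lambda_0)}\cap\operatorname{dom}B\bigr)\subset\operatorname{ran}\Gamma_0$; (iii) $\operatorname{ran}\Gamma_1\subset\operatorname{dom}B$; (iv) $B(\operatorname{ran}\Gamma_1)\subset\operatorname{ran}\Gamma_0$ or $\lambda_0\in\rho(A_1)$. Then $A_{[B]}$ is a closed extension of $S$ in $\mathcal H$ with $\lambda_0\in\rho(A_{[B]})$, and $$(A_{[B]}-\lambda)^{-1}=(A_0-\lambda)^{-1}+\gamma(\lambda)\bigl(I-BM(\lambda)\bigr)^{-1}B\gamma(\overline\lambda)^*$$ holds for all $\lambda\in\rho(A_{[B]})\cap\rho(A_0)$. Further, let $B'$ be a linear operator in $\mathcal G$ that satisfies (i)–(iv) with $B$ replaced by $B'$ and $\lambda_0$ replaced by $\overline{\lambda_0}$, and assume that $(Bx,y)=(x,B'y)$ for all $x\in\operatorname{dom}B$, $y\in\operatorname{dom}B'$. Then $A_{[B']}$ is closed and $A_{[B']}=A_{[B]}^*$. In particular, $\overline{\lambda_0}\in\rho(A_{[B']})$.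
   Context: Quasi boundary triple: let $S$ be a densely defined, closed, symmetric operator in a Hilbert space $\mathcal H$ and $T\subset S^*$ a linear operator with $\overline T=S^*$. $\{\mathcal G,\Gamma_0,\Gamma_1\}$ is a quasi boundary triple for $T\subset S^*$ if $\mathcal G$ is a Hilbert space and $\Gamma_0,\Gamma_1:\operatorname{dom}T\to\mathcal G$ are linear maps such that: (1) $(Tf,g)-(f,Tg)=(\Gamma_1f,\Gamma_0g)-(\Gamma_0f,\Gamma_1g)$ for all $f,g\in\operatorname{dom}T$; (2) $(\Gamma_0,\Gamma_1)^\top:\operatorname{dom}T\to\mathcal G\times\mathcal G$ has dense range; (3) $A_0:=T\upharpoonright\ker\Gamma_0$ is self-adjoint in $\mathcal H$. Put $A_1:=T\upharpoonright\ker\Gamma_1$ (symmetric, not necessarily self-adjoint). For $\lambda\in\rho(A_0)$ one has $\operatorname{dom}T=\ker\Gamma_0\dotplus\ker(T-\lambda)$, so $\Gamma_0\upharpoonright\ker(T-\lambda)$ is injective. The $\gamma$-field and Weyl function are $\gamma(\lambda)=(\Gamma_0\upharpoonright\ker(T-\lambda))^{-1}$ and $M(\lambda)=\Gamma_1\gamma(\lambda)$, both defined on the dense subspace $\operatorname{ran}\Gamma_0$ of $\mathcal G$. $\gamma(\lambda)$ is bounded and $\gamma(\lambda)^*=\Gamma_1(A_0-\overline\lambda)^{-1}$ is bounded and everywhere defined from $\mathcal H$ to $\mathcal G$; $M(\lambda)$ is closable (in general unbounded), and $\overline{M(\lambda)}$ is its closure. For a linear operator $B$ in $\mathcal G$: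 $A_{[B]}f=Tf$, $\operatorname{dom}A_{[B]}=\{f\in\operatorname{dom}T:\Gamma_1f\in\operatorname{dom}B,\ \Gamma_0f=B\Gamma_1f\}$. Products of operators are taken on their natural domains. *)

(* Defs.v *)
From HB Require Import structures.
From mathcomp Require Import all_boot all_order all_algebra.
From mathcomp Require Import complex.
From mathcomp Require Import all_classical all_reals all_analysis.

Set Implicit Arguments.
Unset Strict Implicit.
Unset Printing Implicit Defensive.

Import Order.TTheory GRing.Theory Num.Theory numFieldNormedType.Exports.

Local Open Scope classical_set_scope.
Local Open Scope ring_scope.
Local Open Scope complex_scope.

(* Complex Hilbert spaces; [inner] is linear in its first argument and
   conjugate-linear in its second one. *)
HB.mixin Record CompleteNormedModule_isHilbert (R : realType) H
    of CompleteNormedModule R[i] H := {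
  inner : {dot H for Num.conj};
  sqr_normE : forall x : H, `|x| ^+ 2 = inner x x }.

#[short(type="hilbertType")]
HB.structure Definition Hilbert (R : realType) :=
  {H of CompleteNormedModule_isHilbert R H & CompleteNormedModule R[i] H}.

(* A (possibly unbounded, not everywhere defined) linear operator from H to K
   is identified with its graph, a set of pairs satisfying [linear_op].  The
   operations below make sense for arbitrary sets of pairs; equality and
   inclusion of graphs are equality and extension of operators, including
   their domains, and the closure of an operator is the topological closure of
   its graph in H * K. *)
Section Operators.
Context {R : realType}.
Implicit Types H K L : hilbertType R.

Definition linear_op H K (A : set (H * K)) : Prop :=
  [/\ A (0, 0),
      forall (a : R[i]) x y x' y',
        A (x, y) -> A (x', y') -> A (a *: x + x', a *: y + y')
    & forall x y y', A (x, y) -> A (x, y') -> y = y'].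

Definition op_dom H K (A : set (H * K)) : set H := [set x | exists y, A (x, y)].

Definition op_ran H K (A : set (H * K)) : set K := [set y | exists x, A (x, y)].

Definition op_ker H K (A : set (H * K)) : set H := [set x | A (x, 0)].

(* A (D `&` dom A) *)
Definition op_image H K (A : set (H * K)) (D : set H) : set K :=
  [set y | exists2 x, D x & A (x, y)].

Definition op_restrict H K (A : set (H * K)) (D : set H) : set (H * K) :=
  [set p | A p /\ D p.1].

Definition op_inv H K (A : set (H * K)) : set (K * H) :=
  [set p | A (p.2, p.1)].

(* The operator c I, defined everywhere. *)
Definition op_scalar H (c : R[i]) : set (H * H) := [set p | p.2 = c *: p.1].

Definition op_add H K (A B : set (H * K)) : set (H * K) :=
  [set p | exists y z, [/\ A (p.1, y), B (p.1, z) & p.2 = y + z]].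

Definition op_sub H K (A B : set (H * K)) : set (H * K) :=
  [set p | exists y z, [/\ A (p.1, y), B (p.1, z) & p.2 = y - z]].

(* The product B A. *)
Definition op_mul H K L (B : set (K * L)) (A : set (H * K)) : set (H * L) :=
  [set p | exists2 y, A (p.1, y) & B (y, p.2)].

(* The graph of an operator when A is densely defined. *)
Definition op_adjoint H K (A : set (H * K)) : set (K * H) :=
  [set p | forall x y, A (x, y) -> inner y p.1 = inner x p.2].

Definition closed_op H K (A : set (H * K)) : Prop := linear_op A /\ closed A.

Definition closable_op H K (A : set (H * K)) : Prop :=
  linear_op A /\ linear_op (closure A).

Definition bounded_op H K (A : set (H * K)) : Prop :=
  exists c : R, forall x y, A (x, y) -> `|y| <= c%:C * `|x|.

Definition symmetric_op H (A : set (H * H)) : Prop := A `<=` op_adjoint A.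

Definition selfadjoint_op H (A : set (H * H)) : Prop :=
  dense (op_dom A) /\ A = op_adjoint A.

Definition resolvent H (A : set (H * H)) (z : R[i]) : set (H * H) :=
  op_inv (op_sub A (op_scalar z)).

Definition resolvent_set H (A : set (H * H)) : set R[i] :=
  [set z | [/\ linear_op (resolvent A z), op_dom (resolvent A z) = setT
             & bounded_op (resolvent A z)]].

End Operators.

Section QuasiBoundaryTriple.
Context {R : realType} {H G : hilbertType R}.
Variables (T : set (H * H)) (Gamma0 Gamma1 : set (H * G)).

Definition A_0 : set (H * H) := op_restrict T (op_ker Gamma0).

Definition A_1 : set (H * H) := op_restrict T (op_ker Gamma1).

Definition quasi_boundary_triple (S : set (H * H)) : Prop :=
  [/\ [/\ linear_op T, T `<=` op_adjoint S & closure T = op_adjoint S],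
      [/\ linear_op Gamma0, linear_op Gamma1,
          op_dom Gamma0 = op_dom T & op_dom Gamma1 = op_dom T],
      forall f Tf f0 f1 g Tg g0 g1,
        T (f, Tf) -> Gamma0 (f, f0) -> Gamma1 (f, f1) ->
        T (g, Tg) -> Gamma0 (g, g0) -> Gamma1 (g, g1) ->
        inner Tf g - inner f Tg = inner f1 g0 - inner f0 g1,
      dense [set p : G * G |
              exists2 f, Gamma0 (f, p.1) & Gamma1 (f, p.2)]
    & selfadjoint_op A_0].

Definition gamma_field (z : R[i]) : set (G * H) :=
  op_inv (op_restrict Gamma0 (op_ker (op_sub T (op_scalar z)))).

Definition weyl (z : R[i]) : set (G * G) := op_mul Gamma1 (gamma_field z).

Definition A_B (B : set (G * G)) : set (H * H) :=
  [set p | T p /\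
    exists x y, [/\ Gamma1 (p.1, x), B (x, y) & Gamma0 (p.1, y)]].

Definition boundary_conditions (B : set (G * G)) (z : R[i]) : Prop :=
  [/\ resolvent_set (op_mul B (closure (weyl z))) 1,
      op_image B (op_ran (closure (weyl z)) `&` op_dom B) `<=` op_ran Gamma0,
      op_ran Gamma1 `<=` op_dom B
    & op_image B (op_ran Gamma1) `<=` op_ran Gamma0 \/ resolvent_set A_1 z].

End QuasiBoundaryTriple.

(* Main.v *)
Require Import Defs.
From HB Require Import structures.
From mathcomp Require Import all_boot all_order all_algebra.
From mathcomp Require Import complex.
From mathcomp Require Import all_classical all_reals all_analysis.
From mathcomp Require Import ring lra.

(* For lambda in rho(A_0), dom T is the direct sum of ker Gamma_0 and
   ker (T - lambda).  Hence solving (A_[B] - lambda0) f = h amounts to finding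
   x = Gamma_0 f with x - B M(lambda0) x = B Gamma_1 (A_0 - lambda0)^-1 h.
   Hypothesis (i) solves this equation for the closure of M(lambda0), and (ii)
   and (iv) put the solution back into ran Gamma_0, where M(lambda0) agrees with
   its closure.  The solution operator is bounded because the operator
   Gamma_1 (A_0 - lambda0)^-1 and its product with B are closable and everywhere
   defined, so that the closed graph theorem applies to both; gamma(lambda0) is
   bounded because its adjoint is an operator of this kind.  Green's identity
   gives that A_[B'] is contained in A_[B]^*; since A_[B'] - conj lambda0 is onto
   and A_[B]^* - conj lambda0 is injective, the two are equal.  That conj lambda
   lies in rho(A_0) whenever lambda does comes from the Riesz representation
   theorem. *)

Set Implicit Arguments.
Unset Strict Implicit.
Unset Printing Implicit Defensive.

Import Order.TTheory GRing.Theory Num.Theory numFieldNormedType.Exports.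

Local Open Scope classical_set_scope.
Local Open Scope ring_scope.
Local Open Scope complex_scope.

(** * Real parts of norms and inner products *)

Section HilbertBasics.
Context {R : realType} {H : hilbertType R}.
Implicit Types (x y z : H) (a : R).

(* Norms are valued in R[i], whose order is partial; [nrm] and [rip] transfer
   estimates to R. *)
Definition nrm x : R := complex.Re `|x|.
Definition rip x y : R := complex.Re (inner x y).

Lemma nrmE x : `|x| = (nrm x)%:C.
Proof.
rewrite /nrm; case: `|x| (normr_ge0 x) => a b; rewrite lecE /=.
by move=> /andP[/eqP -> _].
Qed.

Lemma nrm_ge0 x : 0 <= nrm x.
Proof. by have := normr_ge0 x; rewrite nrmE lecR. Qed.

Lemma nrm_eq0 x : nrm x = 0 -> x = 0.
Proof. by move=> e; apply/eqP; rewrite -normr_eq0 nrmE e. Qed.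

Lemma nrm0 : nrm 0 = 0.
Proof. by rewrite /nrm normr0. Qed.

Lemma nrmD x y : nrm (x + y) <= nrm x + nrm y.
Proof. by have := ler_normD x y; rewrite !nrmE -rmorphD /= lecR. Qed.

Lemma nrmN x : nrm (- x) = nrm x.
Proof. by rewrite /nrm normrN. Qed.

Lemma nrmBC x y : nrm (x - y) = nrm (y - x).
Proof. by rewrite -nrmN opprB. Qed.

Lemma nrm_sub_trans z x y : nrm (x - y) <= nrm (x - z) + nrm (z - y).
Proof. by rewrite -{1}(subrK z x) -addrA nrmD. Qed.

Lemma nrmZ (c : R[i]) x : nrm (c *: x) = complex.Re `|c| * nrm x.
Proof.
rewrite /nrm normrZ (nrmE x) /=.
by case: `|c| => a b; rewrite /= mulr0 subr0.
Qed.

Lemma nrmZr a x : nrm (a%:C *: x) = `|a| * nrm x.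
Proof. by rewrite nrmZ normc_def /= expr0n /= addr0 sqrtr_sqr. Qed.

Lemma innerDl x y z : inner (x + y) z = inner x z + inner y z.
Proof. by rewrite linearDl. Qed.

Lemma innerDr x y z : inner z (x + y) = inner z x + inner z y.
Proof. by rewrite linearD. Qed.

Lemma innerZl (c : R[i]) x y : inner (c *: x) y = c * inner x y.
Proof. by rewrite linearZl_LR. Qed.

Lemma innerZr (c : R[i]) x y : inner x (c *: y) = Num.conj c * inner x y.
Proof. by rewrite linearZ. Qed.

Lemma innerNl x y : inner (- x) y = - inner x y.
Proof. by rewrite -scaleN1r innerZl mulN1r. Qed.

Lemma innerNr x y : inner x (- y) = - inner x y.
Proof. by rewrite -scaleN1r innerZr rmorphN1 mulN1r. Qed.

Lemma innerBr x y z : inner z (x - y) = inner z x - inner z y.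
Proof. by rewrite innerDr innerNr. Qed.

Lemma inner0l x : inner 0 x = 0.
Proof. by rewrite linear0l. Qed.

Lemma inner0r x : inner x 0 = 0.
Proof. by rewrite linear0. Qed.

Lemma innerC x y : inner x y = Num.conj (inner y x).
Proof. by rewrite hermC /= expr0 mul1r. Qed.

Lemma rip_nrm x : rip x x = nrm x ^+ 2.
Proof. by rewrite /rip -sqr_normE nrmE -rmorphXn. Qed.

Lemma ripDl x y z : rip (x + y) z = rip x z + rip y z.
Proof. by rewrite /rip innerDl raddfD. Qed.

Lemma ripDr x y z : rip z (x + y) = rip z x + rip z y.
Proof. by rewrite /rip innerDr raddfD. Qed.

Lemma ripNl x y : rip (- x) y = - rip x y.
Proof. by rewrite /rip innerNl raddfN. Qed.

Lemma ripNr x y : rip x (- y) = - rip x y.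
Proof. by rewrite /rip innerNr raddfN. Qed.

Lemma ripC x y : rip x y = rip y x.
Proof. by rewrite /rip innerC; case: (inner y x). Qed.

Lemma ripZl a x y : rip (a%:C *: x) y = a * rip x y.
Proof. by rewrite /rip innerZl; case: (inner x y) => u v /=;
  rewrite mul0r subr0. Qed.

Lemma ripZr a x y : rip x (a%:C *: y) = a * rip x y.
Proof. by rewrite ripC ripZl ripC. Qed.

Lemma nrmD_sqr x y : nrm (x + y) ^+ 2 = nrm x ^+ 2 + 2 * rip x y + nrm y ^+ 2.
Proof. by rewrite -!rip_nrm ripDl !ripDr (ripC y x); ring. Qed.

Lemma nrmB_sqr x y : nrm (x - y) ^+ 2 = nrm x ^+ 2 - 2 * rip x y + nrm y ^+ 2.
Proof. by rewrite nrmD_sqr ripNr nrmN; ring. Qed.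

(** Expand the squared norm of |y| x - |x| y and divide by |x| |y|. *)
Lemma rip_le x y : rip x y <= nrm x * nrm y.
Proof.
have [/nrm_eq0 ->|x0] := eqVneq (nrm x) 0.
  by rewrite /rip inner0l /= mulr_ge0 ?nrm_ge0.
have [/nrm_eq0 ->|y0] := eqVneq (nrm y) 0.
  by rewrite /rip inner0r /= mulr_ge0 ?nrm_ge0.
have p : 0 < nrm x * nrm y by rewrite mulr_gt0 // lt_def ?x0 ?y0 nrm_ge0.
have := sqr_ge0 (nrm ((nrm y)%:C *: x - (nrm x)%:C *: y)).
rewrite nrmB_sqr !nrmZr ripZl ripZr !ger0_norm ?nrm_ge0 // => h.
rewrite -(ler_pM2l p); move: h; lra.
Qed.

Lemma rip_norm_le x y : `|rip x y| <= nrm x * nrm y.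
Proof.
rewrite ler_norml rip_le andbT lerNl -ripNl; apply: le_trans (rip_le _ _) _.
by rewrite nrmN.
Qed.

(* Rotating by all scalars recovers the imaginary part from [rip]. *)
Lemma inner_ext (c1 c2 : R[i]) :
  (forall c : R[i], complex.Re (c * c1) = complex.Re (c * c2)) -> c1 = c2.
Proof.
move=> h; have := h 1; have := h 'i; case: c1 c2 {h} => [a b] [a' b'] /=.
by rewrite !mul0r !mul1r !sub0r !subr0 => /oppr_inj -> ->.
Qed.

End HilbertBasics.

(** * Completeness and the Riesz representation theorem *)

Section HilbertTopology.
Context {R : realType}.
Implicit Types H K : hilbertType R.

Lemma gt0_real (e : R[i]) : 0 < e -> e = (complex.Re e)%:C /\ 0 < complex.Re e.
Proof. by case: e => a b; rewrite ltcE /= => /andP[/eqP -> ?]. Qed.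

Lemma ball_nrmE H (x y : H) (e : R) : ball x e%:C y <-> nrm (x - y) < e.
Proof. by rewrite -ball_normE /ball_ /= nrmE ltcR. Qed.

(** Balls have radii in R[i], but a positive element of R[i] is real, so real radii suffice. *)
Lemma closure_pairP H K (A : set (H * K)) p :
  closure A p <-> forall e : R, 0 < e ->
    exists q, [/\ A q, nrm (p.1 - q.1) < e & nrm (p.2 - q.2) < e].
Proof.
split=> [cA e e0|h U /nbhs_ballP[e /= e0 sU]].
  have /cA[q [Aq [/ball_nrmE ? /ball_nrmE ?]]] : nbhs p (ball p e%:C).
    by apply: nbhsx_ballx; rewrite ltcR.
  by exists q.
have [eE e1] := gt0_real e0; have [q [Aq q1 q2]] := h _ e1.
by exists q; split=> //; apply: sU; rewrite eE; split; apply/ball_nrmE.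
Qed.

Lemma dense_pairP H K (A : set (H * K)) : dense A ->
  forall p (e : R), 0 < e ->
    exists q, [/\ A q, nrm (p.1 - q.1) < e & nrm (p.2 - q.2) < e].
Proof.
move=> dA p; apply/closure_pairP => U.
rewrite nbhsE => hO; case: hO => O [Oo Op] sO.
have [|q [Oq Aq]] := dA O _ Oo; first by exists p.
by exists q; split; first by []; exact: sO.
Qed.

Lemma half_pow_lt (c e : R) : 0 < e -> exists n : nat, c / 2 ^+ n < e.
Proof.
move=> e0; have [c0|c0] := lerP c 0.
  by exists 0%N; rewrite expr0 divr1; apply: le_lt_trans e0.
exists (Num.trunc (c / e)).+1; rewrite ltr_pdivrMr ?exprn_gt0 //.
rewrite mulrC -ltr_pdivrMr //; apply: lt_trans (truncnS_gt _) _.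
by rewrite -natrX ltr_nat ltn_expl.
Qed.

Lemma le_half_pow (c a b : R) : (forall n : nat, a <= b + c / 2 ^+ n) -> a <= b.
Proof.
move=> h; rewrite leNgt; apply/negP => ba.
have [n] := half_pow_lt c (etrans (subr_gt0 _ _) ba).
by have := h n; lra.
Qed.

Lemma complete_half_pow H (u : nat -> H) (c : R) :
  (forall n, nrm (u n.+1 - u n) <= c / 2 ^+ n.+1) ->
  exists l, forall n, nrm (l - u n) <= c / 2 ^+ n.
Proof.
move=> hu.
have half n : c / 2 ^+ n.+1 = c / 2 ^+ n / 2.
  by rewrite exprSr invfM mulrA.
have c0 : 0 <= c.
  have := le_trans (nrm_ge0 _) (hu 0%N); rewrite expr1; lra.
(* The subtracted term makes the geometric sum telescope in the induction on k. *)
have step n k : nrm (u (n + k)%N - u n) <= c / 2 ^+ n - c / 2 ^+ (n + k)%N.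
  elim: k => [|k IH]; first by rewrite addn0 !subrr nrm0.
  rewrite addnS; apply: le_trans (nrm_sub_trans (u (n + k)%N) _ _) _.
  by have := hu (n + k)%N; have := half (n + k)%N; move: IH; lra.
have pos n : 0 <= c / 2 ^+ n by rewrite divr_ge0 // exprn_ge0.
have bnd n m : (n <= m)%N -> nrm (u m - u n) <= c / 2 ^+ n.
  by move=> nm; have := step n (m - n)%N; rewrite subnKC //; have := pos m; lra.
have /cauchy_cvgP/cvg_ballP cu : cauchy (u @ \oo).
  apply: cauchy_exP => e e0; have [eE e1] := gt0_real e0.
  have [N hN] := half_pow_lt c e1; exists (u N).
  exists N => // m /= Nm; rewrite eE; apply/ball_nrmE.
  by rewrite nrmBC; apply: le_lt_trans hN; exact: bnd.
exists (lim (u @ \oo)) => n; apply/ler_addgt0Pl => e e0.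
have [|N _ hN] := cu e%:C; first by rewrite ltcR.
have /ball_nrmE h1 := hN (maxn N n) (leq_maxl _ _).
have h2 := bnd _ _ (leq_maxr N n).
by apply: le_trans (nrm_sub_trans (u (maxn N n)) _ _) _; apply: lerD => //;
  exact: ltW.
Qed.

(** Variational proof: u minimises J x = |x|^2 - 2 Re (phi x), which is bounded below by - C^2, and
    the parallelogram identity makes a minimising sequence Cauchy. *)
Lemma riesz H (phi : H -> R[i]) (C : R) :
  (forall a x y, phi (a *: x + y) = a * phi x + phi y) ->
  (forall x, complex.Re (phi x) <= C * nrm x) ->
  exists u, forall x, phi x = inner x u.
Proof.
move=> lin bnd; pose f x := complex.Re (phi x).
have fD x y : f (x + y) = f x + f y.
  by rewrite /f -[x]scale1r lin mul1r scale1r raddfD.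
have f0 : f 0 = 0 by have := fD 0 0; rewrite addr0; lra.
have fZ (a : R) x : f (a%:C *: x) = a * f x.
  rewrite -[_ *: _]addr0 {1}/f lin raddfD /= -[complex.Re (phi 0)]/(f 0) f0
    addr0 /f.
  by case: (phi x) => v w /=; rewrite mul0r subr0.
pose J x := nrm x ^+ 2 - 2 * f x.
have Jlb x : - C ^+ 2 <= J x.
  have := bnd x; rewrite /J -/(f x) => h.
  have := sqr_ge0 (nrm x - C); nra.
have Jinf : has_inf (range J).
  by split; [exists (J 0); exists 0 | exists (- C ^+ 2) => _ [x _ <-]].
have Jm x : inf (range J) <= J x by apply: ge_inf; [case: Jinf | exists x].
set m := inf _ in Jm.
(* The tolerance is a square because the parallelogram identity controls squared distances; the
   distances themselves are then of order 2^-n. *)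
have ex n : exists x, J x < m + (1 / 2 ^+ n) ^+ 2.
  have e0 : 0 < (1 / 2 ^+ n) ^+ 2 :> R by rewrite exprn_gt0 // divr_gt0 //
    exprn_gt0.
  by have [_ [x _ <-]] := inf_adherent e0 Jinf; exists x.
have [x hx] := choice ex.
have par y z : nrm (y - z) ^+ 2 =
  2 * J y + 2 * J z - 4 * J ((1 / 2)%:C *: (y + z)).
  rewrite /J fZ fD nrmZr ger0_norm ?divr_ge0 // exprMn nrmB_sqr nrmD_sqr.
  by field.
have cau n : nrm (x n.+1 - x n) <= 4 / 2 ^+ n.+1.
  have := par (x n.+1) (x n).
  have := hx n.+1; have := hx n; have := Jm ((1 / 2)%:C *: (x n.+1 + x n)).
  have -> : 1 / 2 ^+ n = (1 / 2 ^+ n.+1) * 2 :> R.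
    by rewrite exprSr invfM; field; rewrite expf_neq0.
  have -> : 4 / 2 ^+ n.+1 = 4 * (1 / 2 ^+ n.+1) :> R by rewrite mulrA mulr1.
  have : 0 <= 1 / 2 ^+ n.+1 :> R by rewrite divr_ge0 ?exprn_ge0.
  have := nrm_ge0 (x n.+1 - x n).
  move: (1 / _) (nrm _) => t v v0 t0 h1 h2 h3 h4.
  rewrite leNgt; apply/negP => vt; nra.
have [u hu] := complete_half_pow cau.
exists u => z0.
suff key z : f z = rip z u.
  by apply: inner_ext => c; rewrite -innerZl -/(rip _ _) -key -[c *: z0]addr0
    {1}/f lin raddfD /= -[complex.Re (phi 0)]/(f 0) f0 addr0.
(* First-order optimality of x n up to its tolerance: compare J at x n and at x n + s t z with t =
   2^-n, then divide by t. The two signs s = 1 and s = -1 give both inequalities in the limit. *)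
have near_min n (s : R) : s ^+ 2 = 1 ->
    s * (f z - rip (x n) z) <= (nrm z ^+ 2 + 1) * (1 / 2 ^+ n).
  move=> s1; have t0 : 0 < 1 / 2 ^+ n :> R by rewrite divr_gt0 ?exprn_gt0.
  have := hx n; have := Jm (x n + (s * (1 / 2 ^+ n))%:C *: z).
  rewrite /J fD fZ nrmD_sqr ripZr nrmZr [(_ * nrm z) ^+ 2]exprMn -normrX
    ger0_norm ?sqr_ge0 //.
  rewrite [(s * _) ^+ 2]exprMn s1.
  move: (1 / _) t0 => t t0 h1 h2; rewrite -(ler_pM2l t0).
  by have := mulr_ge0 (sqr_ge0 t) (addr_ge0 (sqr_ge0 (nrm z)) ler01); lra.
have near_u n (s : R) : s ^+ 2 = 1 ->
    s * (f z - rip z u) <= 0 + (nrm z ^+ 2 + 1 + 4 * nrm z) / 2 ^+ n.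
  move=> s1; have := near_min n s s1.
  have : s * rip (x n - u) z <= 4 / 2 ^+ n * nrm z.
    have /eqP := s1; rewrite sqrf_eq1 => /orP[]/eqP->;
      rewrite ?mul1r ?mulN1r -?ripNl;
      apply: le_trans (rip_le _ _) _; apply: ler_wpM2r;
        rewrite ?nrm_ge0 // ?nrmN //.
      by rewrite nrmBC.
    by rewrite nrmBC.
  rewrite ripDl ripNl (ripC u z) mul1r.
  by move: (_^-1) => t; lra.
have h1 := le_half_pow (fun n => near_u n 1 (expr1n _ _)).
have h2 := le_half_pow (fun n => near_u n (-1) (etrans (sqrrN 1) (expr1n _ _))).
apply/eqP; rewrite eq_le; move: h1 h2; lra.
Qed.

End HilbertTopology.

(** * The closed graph theorem *)

Section LinearOp.
Context {R : realType} {H K : hilbertType R}.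
Implicit Types (A : set (H * K)) (x : H) (y : K).

Lemma linear_opD A x y x' y' : linear_op A ->
  A (x, y) -> A (x', y') -> A (x + x', y + y').
Proof. by move=> [_ h _] Ax Ay; have := h 1 _ _ _ _ Ax Ay; rewrite !scale1r. Qed.

Lemma linear_opZ A (c : R[i]) x y : linear_op A -> A (x, y) -> A (c *: x, c *: y).
Proof. by move=> [h0 h _] Ax; have := h c _ _ _ _ Ax h0; rewrite !addr0. Qed.

Lemma linear_opB A x y x' y' : linear_op A ->
  A (x, y) -> A (x', y') -> A (x - x', y - y').
Proof.
move=> lA Ax Ay; apply: linear_opD => //.
by rewrite -scaleN1r -[- y']scaleN1r; apply: linear_opZ.
Qed.

End LinearOp.

Section ClosedGraph.
Context {R : realType} {H K : hilbertType R}.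
Implicit Types (x : H) (y : K) (L : set (H * K)).

Let small L (n : nat) : set H := [set x | exists2 y, L (x, y) & nrm y <= n%:R].

(* Baire's argument: the sets [small L n] cover H, so one of them is somewhere
   dense. *)
Lemma small_somewhere_dense L : op_dom L = setT ->
  exists n x0 (r : R), 0 < r /\ forall x, nrm (x - x0) < r ->
    forall e : R, 0 < e -> exists2 x', small L n x' & nrm (x - x') < e.
Proof.
move=> domL; apply: contrapT => no.
(* By contradiction, each ball contains a closed ball of at most half the radius that misses
   [small L n]. The premise stands under the existential so that [choice] gives a total function. *)
have ex (q : nat * (H * R)) : exists p : H * R, 0 < q.2.2 ->
    [/\ 0 < p.2, p.2 <= q.2.2 / 2, nrm (p.1 - q.2.1) <= q.2.2 / 2
      & forall x, small L q.1 x -> ~ nrm (p.1 - x) <= p.2].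
  case: q => n [x0 r] /=; have [r0|r0] := ltrP 0 r; last by exists (x0, r).
  apply: contrapT => no'; apply: no; exists n, x0, (r / 2).
  split=> [|x xr e e0]; first by rewrite divr_gt0.
  apply: contrapT => no; apply: no'; exists (x, Num.min (r / 2) (e / 2)) => _ /=.
  split; rewrite ?lt_min ?ge_min ?lexx ?divr_gt0 //; first exact: ltW.
  move=> x' sx'; rewrite le_min => /andP[_ xx']; apply: no; exists x' => //.
  by apply: le_lt_trans xx' _; lra.
have [F hF] := choice ex.
pose s := fix s n := if n is k.+1 then F (k, s k) else (0 : H, 1 : R).
have s_gt0 n : 0 < (s n).2.
  by elim: n => [|n IH] //=; have [] := hF (n, s n) IH.
have hs n := hF (n, s n) (s_gt0 n).
have s_le n : (s n).2 <= 1 / 2 ^+ n.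
  elim: n => [|n IH]; first by rewrite expr0 divr1.
  have [_ h _ _] := hs n; rewrite exprSr invfM mulrA.
  by move: h IH => /=; lra.
have [|l hl] := @complete_half_pow _ _ (fun n => (s n).1) 1.
  move=> n; have [_ _ h _] := hs n; have := s_le n.
  by rewrite exprSr invfM mulrA; move: h => /=; lra.
have step n k : nrm ((s (n + k)%N).1 - (s n).1) <= (s n).2 - (s (n + k)%N).2.
  elim: k => [|k IH]; first by rewrite addn0 !subrr nrm0.
  rewrite addnS; apply: le_trans (nrm_sub_trans (s (n + k)%N).1 _ _) _.
  have [_ h1 h2 _] := hs (n + k)%N; move: IH h1 h2 => /=; lra.
have ls n : nrm (l - (s n).1) <= (s n).2.
  apply: (@le_half_pow _ 1) => k.
  apply: le_trans (nrm_sub_trans (s (n + k)%N).1 _ _) _.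
  have h1 := step n k; have h2 := hl (n + k)%N; have h3 := s_gt0 (n + k)%N.
  have h4 : 1 / 2 ^+ (n + k) <= 1 / 2 ^+ k :> R.
    by rewrite !div1r lef_pV2 ?posrE ?exprn_gt0 // ler_weXn2l ?leq_addl // ler1n.
  by lra.
have [y Ly] : op_dom L l by rewrite domL.
(* The common point l of the nested balls lies in [small L n] for n = trunc |y| + 1, yet also in
   ball n + 1, which avoids that set. *)
have [_ _ _ h] := hs (Num.trunc (nrm y)).+1.
apply: (h l); last by rewrite nrmBC; have := ls (Num.trunc (nrm y)).+2.
by exists y => //; apply: ltW; exact: truncnS_gt.
Qed.

(** Correct the error of an approximate preimage again and again, halving it each time; the images
    form a geometric series. Closability, expressed by the fibre of the closure over 0, identifies
    the limit of the images with y. *)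
Lemma closed_graph L : linear_op L -> op_dom L = setT ->
  (forall y, closure L (0, y) -> y = 0) ->
  exists2 c : R, 0 <= c & forall x y, L (x, y) -> nrm y <= c * nrm x.
Proof.
move=> linL domL closL.
have [n [x0 [r [r0 hr]]]] := small_somewhere_dense domL.
pose C := 4 * n%:R / r.
have C0 : 0 <= C by rewrite divr_ge0 ?mulr_ge0 // ltW.
have approx (rho : R) x : 0 < rho -> nrm x <= rho ->
    exists q, [/\ L q, nrm (x - q.1) <= rho / 2 & nrm q.2 <= C * rho].
  (* s shrinks x to length at most r / 2, so x0 + s x stays in the ball. The difference of
     approximations of x0 + s x and x0, each within r / 8, has error r / 4 = s rho / 2 and image of
     norm at most 2 n = s C rho. *)
  move=> rho0 xrho; pose s := r / (2 * rho).
  have s0 : 0 < s by rewrite divr_gt0 ?mulr_gt0.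
  have d0 : 0 < r / 8 by rewrite divr_gt0.
  have [|a [a' La na] ha] := hr (x0 + s%:C *: x) _ _ d0.
    rewrite addrC addKr nrmZr gtr0_norm //;
      apply: le_lt_trans (ler_wpM2l (ltW s0) xrho) _.
    have -> : s * rho = r / 2 by rewrite /s; field; rewrite gt_eqF.
    lra.
  have [|b [b' Lb nb] hb] := hr x0 _ _ d0; first by rewrite subrr nrm0.
  exists ((s^-1)%:C *: (a - b), (s^-1)%:C *: (a' - b')); split => /=.
  - by apply: linear_opZ => //; exact: linear_opB.
  - have -> : x - (s^-1)%:C *: (a - b) =
    (s^-1)%:C *: ((x0 + s%:C *: x - a) - (x0 - b)).
      have -> : x0 + s%:C *: x - a - (x0 - b) = s%:C *: x - (a - b).
        rewrite opprB [b - x0]addrC addrA [x0 + _]addrC.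
        by rewrite [_ - a - x0]addrAC addrK opprB addrA addrAC.
      by rewrite [RHS]scalerBr scalerA -rmorphM mulVf ?gt_eqF // scale1r.
    rewrite nrmZr gtr0_norm ?invr_gt0 // ler_pdivrMl //.
    have -> : s * (rho / 2) = r / 4 by rewrite /s; field; rewrite gt_eqF.
    by apply: le_trans (nrmD _ _) _; rewrite nrmN; lra.
  - rewrite nrmZr gtr0_norm ?invr_gt0 // ler_pdivrMl //.
    have -> : s * (C * rho) = 2 * n%:R by rewrite /s /C; field; rewrite !gt_eqF.
    by apply: le_trans (nrmD _ _) _; rewrite nrmN; lra.
exists (2 * C) => [|x y Lxy]; first by rewrite mulr_ge0.
have [x00|xn0] := eqVneq (nrm x) 0.
  have x0E := nrm_eq0 x00; rewrite x0E in Lxy.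
  have -> : y = 0 by case: linL => L0 _ /(_ _ _ _ Lxy L0).
  by rewrite nrm0 mulr_ge0 ?nrm_ge0 // mulr_ge0.
set rho := nrm x.
have rho0 : 0 < rho by rewrite lt_def xn0 nrm_ge0.
have ex (q : nat * (H * K)) : exists p : H * K,
    L q.2 -> nrm (x - q.2.1) <= rho / 2 ^+ q.1 ->
    [/\ L p, nrm (x - p.1) <= rho / 2 ^+ q.1.+1
      & nrm (p.2 - q.2.2) <= 2 * C * rho / 2 ^+ q.1.+1].
  case: q => k [s t] /=; have [[Lst hs]|no] :=
    EM (L (s, t) /\ nrm (x - s) <= rho / 2 ^+ k); last first.
    by exists (s, t) => ? ?; case: no.
  have [|[a b] [Lab h1 h2]] := approx (rho / 2 ^+ k) (x - s) _ hs.
    by rewrite divr_gt0 ?exprn_gt0.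
  exists (s + a, t + b) => _ _ /=; split; first exact: linear_opD.
    by rewrite opprD addrA exprSr invfM mulrA.
  rewrite addrC addKr exprSr invfM.
  by apply: le_trans h2 _; rewrite le_eqVlt; apply/orP; left; apply/eqP; field;
    rewrite expf_neq0.
have [F hF] := choice ex.
pose s := fix s n := if n is k.+1 then F (k, s k) else (0 : H, 0 : K).
have hs k : L (s k) /\ nrm (x - (s k).1) <= rho / 2 ^+ k.
  elim: k => [|k [IH1 IH2]] /=; first by rewrite subr0 expr0 divr1; case: linL.
  by have [] := hF (k, s k) IH1 IH2.
have [|l hl] := @complete_half_pow _ _ (fun n => (s n).2) (2 * C * rho).
  by move=> k; have [h1 h2] := hs k; have [] := hF (k, s k) h1 h2.
(* The bound is [hl] at 0, where the sequence starts from 0. The pairs (x, y) - s k lie in L and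
   tend to (0, y - l). *)
suff -> : y = l by have := hl 0%N; rewrite /= subr0 expr0 divr1.
apply/subr0_eq/closL/closure_pairP => e e0.
have [k hk] := half_pow_lt (rho + 2 * C * rho) e0.
have [Ls hx] := hs k; have ly := hl k.
have p1 : 0 <= rho / 2 ^+ k by rewrite divr_ge0 ?ltW // exprn_gt0.
have p2 : 0 <= 2 * C * rho / 2 ^+ k.
  by apply: divr_ge0; [apply: mulr_ge0;
    [exact: mulr_ge0 | exact: ltW] | exact: exprn_ge0].
rewrite mulrDl in hk.
exists (x - (s k).1, y - (s k).2); split => /=.
- by apply: linear_opB => //; case: (s k) Ls.
- by rewrite sub0r nrmN; lra.
- by rewrite opprB addrC addrA subrK nrmBC; lra.
Qed.

End ClosedGraph.

(** * Resolvents and adjoints *)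

Section Resolvents.
Context {R : realType}.
Implicit Types H K L : hilbertType R.

Lemma linear_op_mul H K L (B : set (K * L)) (A : set (H * K)) :
  linear_op B -> linear_op A -> linear_op (op_mul B A).
Proof.
move=> [B0 BD Bf] [A0 AD Af]; split; first by exists 0.
- by move=> a x y x' y' [u Au Bu] [v Av Bv]; exists (a *: u + v);
  [exact: AD | exact: BD].
- by move=> x y y' [u Au Bu] [v Av Bv]; move: Bu;
  rewrite (Af _ _ _ Au Av) => Bu; exact: Bf Bu Bv.
Qed.

Lemma bounded_opP H K (A : set (H * K)) :
  bounded_op A <-> exists2 c : R, 0 <= c & forall x y, A (x, y) ->
    nrm y <= c * nrm x.
Proof.
split=> [[c hc]|[c c0 hc]].
  exists `|c| => // x y /hc; rewrite !nrmE -rmorphM lecR => h.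
  by apply: le_trans h _; rewrite ler_wpM2r ?nrm_ge0 // ler_norm.
by exists c => x y /hc; rewrite !nrmE -rmorphM lecR.
Qed.

(** Each defining equation is continuous in the pair (f, g). Linearity of A absorbs scalars into (x,
    y), so comparing real parts is enough. *)
Lemma closed_adjoint H K (A : set (H * K)) : linear_op A -> closed (op_adjoint A).
Proof.
move=> linA [f g] /closure_pairP cl x y Axy; apply: inner_ext => c /=.
rewrite -!innerZl -/(rip (c *: y) f) -/(rip (c *: x) g).
have /= {Axy} := linear_opZ c linA Axy; move: (c *: x) (c *: y) => {c}x {}y Axy.
suff h e : 0 < e -> `|rip y f - rip x g| <= 0 + e * (nrm y + nrm x).
  apply/subr0_eq/normr0_eq0/eqP; rewrite eq_le normr_ge0 andbT.
  apply: (@le_half_pow _ (nrm y + nrm x)) => n.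
  by rewrite [_ / _]mulrC; apply: h; rewrite invr_gt0 exprn_gt0.
move=> e0; have [[f' g'] /= [adj h1 h2]] := cl _ e0.
have e1 : rip y f' = rip x g' by rewrite /rip (adj _ _ Axy).
have -> : rip y f - rip x g = rip y (f - f') - rip x (g - g').
  by rewrite !ripDr !ripNr e1; ring.
apply: le_trans (ler_normB _ _) _.
have := rip_norm_le y (f - f'); have := rip_norm_le x (g - g').
have := ler_wpM2l (nrm_ge0 y) (ltW h1); have := ler_wpM2l (nrm_ge0 x) (ltW h2).
lra.
Qed.

Lemma linear_op_combination H K (A : set (H * K)) (a : R[i]) x y x' y' :
  linear_op A -> A (x, y) -> A (x', y') -> A (a *: x + x', a *: y + y').
Proof. by move=> [_ h _]; apply: h. Qed.

Lemma resolventE H (A : set (H * H)) (z : R[i]) h f :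
  resolvent A z (h, f) <-> A (f, h + z *: f).
Proof.
split=> [[y [w /= [Af]]]|Af].
  by rewrite /op_scalar /= => -> ->; rewrite subrK.
by exists (h + z *: f), (z *: f); split=> //=; rewrite addrK.
Qed.

Lemma linear_resolvent H (A : set (H * H)) (z : R[i]) : linear_op A ->
  (forall f, A (f, z *: f) -> f = 0) -> linear_op (resolvent A z).
Proof.
move=> linA inj; split.
- by apply/resolventE; rewrite scaler0 addr0; case: linA.
- move=> a h f h' f' /resolventE Af /resolventE Af'; apply/resolventE.
  have := linear_op_combination a linA Af Af'.
  by rewrite !scalerDr !scalerA [z * a]mulrC addrACA.
- move=> h f f' /resolventE Af /resolventE Af'; apply/subr0_eq/inj.
  have := linear_opB linA Af Af'.
  by rewrite opprD addrACA subrr add0r scalerBr.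
Qed.

Lemma resolvent_inj H (A : set (H * H)) (z : R[i]) f :
  linear_op (resolvent A z) -> A (f, z *: f) -> f = 0.
Proof.
move=> [h0 _ hf] Af; apply: (hf 0) => //.
by apply/resolventE; rewrite add0r.
Qed.

Lemma resolvent_set_ex H (A : set (H * H)) (z : R[i]) h :
  resolvent_set A z -> exists f, A (f, h + z *: f).
Proof.
move=> [_ dom _]; have [f /resolventE] : op_dom (resolvent A z) h by rewrite dom.
by exists f.
Qed.

(** If (A' - conj z) f = h and (A - z) v = f, then |f|^2 = (v, h). Hence the bound of (A - z)^-1
    passes to A', and surjectivity of A' - conj z is all that remains to be assumed. *)
Lemma resolvent_set_adjoint H (A A' : set (H * H)) (z : R[i]) :
  linear_op A' -> A' `<=` op_adjoint A -> resolvent_set A z ->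
  op_dom (resolvent A' (Num.conj z)) = setT -> resolvent_set A' (Num.conj z).
Proof.
move=> linA' adj Az dom'.
have [_ _ /bounded_opP[c c0 hc]] := Az.
have bnd f h : A' (f, h + Num.conj z *: f) -> nrm f <= c * nrm h.
  move=> /adj hf; have [v Av] := resolvent_set_ex f Az.
  have := hf _ _ Av; rewrite /= innerDl innerDr innerZl innerZr conjCK =>
    /addIr fv.
  have vf : nrm v <= c * nrm f by apply: hc; apply/resolventE.
  have [->|f0] := eqVneq (nrm f) 0; first by rewrite mulr_ge0 ?nrm_ge0.
  have f1 : 0 < nrm f by rewrite lt_def f0 nrm_ge0.
  rewrite -(ler_pM2l f1) -expr2 -rip_nrm /rip fv -/(rip v h).
  apply: le_trans (rip_le _ _) _; apply: le_trans (ler_wpM2r (nrm_ge0 h) vf) _.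
  by rewrite mulrAC [_ * nrm f]mulrC.
split=> //.
- apply: linear_resolvent => // f A'f; apply: nrm_eq0; apply/eqP.
  have := bnd f 0; rewrite add0r nrm0 mulr0 => /(_ A'f) f0.
  by rewrite eq_le f0 nrm_ge0.
- by apply/bounded_opP; exists c => // h f /resolventE; apply: bnd.
Qed.

Lemma resolvent_set_conj H (A : set (H * H)) (z : R[i]) : linear_op A ->
  A = op_adjoint A -> resolvent_set A z -> resolvent_set A (Num.conj z).
Proof.
move=> linA adjA Az; apply: (resolvent_set_adjoint linA _ Az);
  first by rewrite -adjA.
have [[r0 rD rf] dom /bounded_opP[c c0 hc]] := Az.
have /choice[r hr] h : exists f, resolvent A z (h, f).
  by have [f Af] := resolvent_set_ex h Az; exists f; apply/resolventE.
apply/seteqP; split=> // h _.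
(* The representative u of x |-> ((A - z)^-1 x, h) solves (A - conj z) u = h, because A equals its
   adjoint. *)
have [||u hu] := @riesz _ _ (fun x => inner (r x) h) (c * nrm h).
- move=> a x y; have -> : r (a *: x + y) = a *: r x + r y.
    by apply: rf (hr _) _; apply: rD.
  by rewrite innerDl innerZl.
- move=> x; apply: le_trans (rip_le _ _) _.
  by rewrite mulrAC ler_wpM2r ?nrm_ge0 //; apply: hc.
exists u; apply/resolventE; rewrite adjA => v w Avw /=.
have vE : v = r (w - z *: v).
  by apply: rf (hr _); apply/resolventE; rewrite subrK.
have vh : inner v h = inner (w - z *: v) u by rewrite -hu -vE.
by rewrite innerDr innerZr conjCK vh -innerZl -innerDl subrK.
Qed.

End Resolvents.

(** * Quasi boundary triples *)

Section QuasiBoundaryTripleTheory.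
Context {R : realType} {H G : hilbertType R}.
Variables (S T : set (H * H)) (Gamma0 Gamma1 : set (H * G)).
Hypothesis qbt : quasi_boundary_triple T Gamma0 Gamma1 S.

Let linT : linear_op T. Proof. by case: qbt => [[]]. Qed.
Let linG0 : linear_op Gamma0. Proof. by case: qbt => _ []. Qed.
Let linG1 : linear_op Gamma1. Proof. by case: qbt => _ []. Qed.

Lemma green f Tf f0 f1 g Tg g0 g1 :
  T (f, Tf) -> Gamma0 (f, f0) -> Gamma1 (f, f1) ->
  T (g, Tg) -> Gamma0 (g, g0) -> Gamma1 (g, g1) ->
  inner Tf g - inner f Tg = inner f1 g0 - inner f0 g1.
Proof. by case: qbt => _ _ h _ _; apply: h. Qed.

Lemma Gamma0_ex f Tf : T (f, Tf) -> exists x, Gamma0 (f, x).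
Proof.
case: qbt => _ [_ _ dom0 _] _ _ _ Tf'.
by have : op_dom Gamma0 f by rewrite dom0; exists Tf.
Qed.

Lemma Gamma1_ex f Tf : T (f, Tf) -> exists x, Gamma1 (f, x).
Proof.
case: qbt => _ [_ _ _ dom1] _ _ _ Tf'.
by have : op_dom Gamma1 f by rewrite dom1; exists Tf.
Qed.

Lemma T_ex f x : Gamma0 (f, x) -> exists Tf, T (f, Tf).
Proof.
case: qbt => _ [_ _ dom0 _] _ _ _ fx.
by have : op_dom T f by rewrite -dom0; exists x.
Qed.

(** The hypothesis says that (b, - a) is orthogonal to the range of (Gamma0, Gamma1), which is
    dense. *)
Lemma dense_ran_Gamma (a b : G) :
  (forall f x y, Gamma0 (f, x) -> Gamma1 (f, y) -> inner b x = inner a y) ->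
  a = 0 /\ b = 0.
Proof.
case: qbt => _ _ _ dG _ ort.
have small n : nrm a ^+ 2 + nrm b ^+ 2 <= 0 + (nrm a + nrm b) / 2 ^+ n.
  have e0 : 0 < (2 ^+ n)^-1 :> R by rewrite invr_gt0 exprn_gt0.
  have [[x y] /= [[f fx fy] hx hy]] := dense_pairP dG (b, - a) e0.
  have e1 : rip b x = rip a y by rewrite /rip (ort _ _ _ fx fy).
  have -> : nrm a ^+ 2 + nrm b ^+ 2 = rip b (b - x) + rip (- a) (- a - y).
    by rewrite -!rip_nrm !ripDr !ripNr !ripNl e1; ring.
  have := rip_le b (b - x); have := rip_le (- a) (- a - y); rewrite nrmN.
  have := ler_wpM2l (nrm_ge0 b) (ltW hx); have := ler_wpM2l (nrm_ge0 a) (ltW hy).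
  by move: (_^-1) => t; lra.
have := le_half_pow small; have := sqr_ge0 (nrm a); have := sqr_ge0 (nrm b).
move=> b0 a0 ab; split; apply: nrm_eq0; apply/eqP; rewrite -sqrf_eq0 eq_le;
  apply/andP; split=> //; lra.
Qed.

Lemma dense_ran_Gamma0 (a b : G) :
  (forall f x, Gamma0 (f, x) -> inner x a = inner x b) -> a = b.
Proof.
move=> h; apply/subr0_eq; have [] // := @dense_ran_Gamma 0 (a - b).
move=> f x y fx _; rewrite inner0l innerC innerBr (h _ _ fx) subrr.
by rewrite rmorph0.
Qed.

Lemma linear_A_0 : linear_op (A_0 T Gamma0).
Proof.
case: (linT) (linG0) => T0 TD Tf [G00 G0D _]; split=> //.
- move=> a x y x' y' [Tx Gx] [Tx' Gx']; split; first exact: TD.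
  by have := G0D a _ _ _ _ Gx Gx'; rewrite scaler0 addr0.
- by move=> x y y' [Tx _] [Tx' _]; exact: Tf Tx Tx'.
Qed.

Lemma A_0_resolvent_conj z : resolvent_set (A_0 T Gamma0) z ->
  resolvent_set (A_0 T Gamma0) (Num.conj z).
Proof.
by apply: resolvent_set_conj; [exact: linear_A_0 | case: qbt => _ _ _ _ []].
Qed.

Lemma linear_A_B (B : set (G * G)) : linear_op B ->
  linear_op (A_B T Gamma0 Gamma1 B).
Proof.
case: (linT) (linG0) (linG1) => T0 TD Tf [G00 G0D _] [G10 G1D _] [B0 BD _]; split.
- by split=> //; exists 0, 0.
- move=> a x y x' y' [/= Tx [u [v [xu uv xv]]]] [/= Tx' [u' [v' [xu' uv' xv']]]].
  split; first exact: TD.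
  by exists (a *: u + u'), (a *: v + v'); split;
    [exact: G1D | exact: BD | exact: G0D].
- by move=> x y y' [Tx _] [Tx' _]; exact: Tf Tx Tx'.
Qed.

Lemma extension_A_B (B : set (G * G)) : linear_op B ->
  S `<=` A_B T Gamma0 Gamma1 B.
Proof.
move=> [B0 _ _] [f g] Sfg.
have [[_ TS _] _ _ _ [_ adjA0]] := qbt.
(* A_0 is contained in S^*, hence S is contained in A_0^* = A_0. *)
have [Tf f0] : A_0 T Gamma0 (f, g).
  rewrite adjA0 => u v [Tuv _] /=.
  by rewrite innerC -(TS _ Tuv _ _ Sfg) /= -innerC.
have [y fy] := Gamma1_ex Tf; split=> //; exists 0, 0; split=> //=.
(* Since T is contained in S^*, the left side of Green's identity vanishes for f in dom S; what
   remains is that y is orthogonal to ran Gamma0. *)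
suff <- : y = 0 by [].
have [] // := @dense_ran_Gamma 0 y.
move=> u x v ux uv; have [Tu Tuu] := T_ex ux.
have := green Tf f0 fy Tuu ux uv; rewrite inner0l subr0 => <-.
by rewrite innerC -(TS _ Tuu _ _ Sfg) -innerC subrr.
Qed.

Lemma gamma_fieldE z x f :
  gamma_field T Gamma0 z (x, f) <-> Gamma0 (f, x) /\ T (f, z *: f).
Proof.
have E h : resolvent T z (h, f) <-> T (f, h + z *: f) by exact: resolventE.
have := E 0; rewrite add0r => E0.
by split=> [[fx k]|[fx Tf]]; split=> //; apply/E0.
Qed.

Lemma weylE z x y : weyl T Gamma0 Gamma1 z (x, y) <->
  exists f, [/\ Gamma0 (f, x), T (f, z *: f) & Gamma1 (f, y)].
Proof.
split=> [[f /gamma_fieldE[fx Tf] fy]|[f [fx Tf fy]]]; first by exists f.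
by exists f => //; apply/gamma_fieldE.
Qed.

Lemma Gamma0_inj z f : resolvent_set (A_0 T Gamma0) z ->
  Gamma0 (f, 0) -> T (f, z *: f) -> f = 0.
Proof. by move=> [lin _ _] f0 Tf; apply: resolvent_inj lin _. Qed.

Lemma gamma_field_uniq z x f f' : resolvent_set (A_0 T Gamma0) z ->
  gamma_field T Gamma0 z (x, f) -> gamma_field T Gamma0 z (x, f') -> f = f'.
Proof.
move=> zA /gamma_fieldE[fx Tf] /gamma_fieldE[fx' Tf'];
  apply/subr0_eq/(Gamma0_inj zA).
  by have := linear_opB linG0 fx fx'; rewrite subrr.
by have := linear_opB linT Tf Tf'; rewrite scalerBr.
Qed.

(* f = u + (f - u) is the decomposition dom T = ker Gamma0 + ker (T - z). *)
Lemma gamma_field_sub_resolvent z h f u x : T (f, h + z *: f) -> Gamma0 (f, x) ->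
  resolvent (A_0 T Gamma0) z (h, u) -> gamma_field T Gamma0 z (x, f - u).
Proof.
move=> Tf fx /resolventE[Tu u0]; apply/gamma_fieldE; split.
  by have := linear_opB linG0 fx u0; rewrite subr0.
by have := linear_opB linT Tf Tu; rewrite opprD addrACA subrr add0r scalerBr.
Qed.

Lemma dom_gamma_field z f x : resolvent_set (A_0 T Gamma0) z ->
  Gamma0 (f, x) -> exists g, gamma_field T Gamma0 z (x, g).
Proof.
move=> zA fx; have [Tf fTf] := T_ex fx.
have [u Au] := resolvent_set_ex (Tf - z *: f) zA.
by exists (f - u); apply: (@gamma_field_sub_resolvent _ (Tf - z *: f)) => //;
  rewrite ?subrK //; apply/resolventE.
Qed.

(** Green's identity between ker (T - conj z) and ker Gamma0 keeps one boundary term. For z in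
    rho(A_0) the operator Gamma1 (A_0 - z)^-1 is everywhere defined, so with
    [gamma_field_adjoint_uniq] this inclusion serves as the equality with gamma(conj z)^*. *)
Lemma gamma_field_adjoint z h k :
  op_mul Gamma1 (resolvent (A_0 T Gamma0) z) (h, k) ->
  op_adjoint (gamma_field T Gamma0 (Num.conj z)) (h, k).
Proof.
move=> [u /resolventE[Tu u0] uk] x y /gamma_fieldE[yx Ty] /=.
have [y1 yy1] := Gamma1_ex Ty; have := green Ty yx yy1 Tu u0 uk.
rewrite /= inner0r sub0r innerDr innerZr innerZl opprD addrCA subrr addr0.
by move/oppr_inj.
Qed.

Lemma gamma_field_adjoint_uniq z h k k' : resolvent_set (A_0 T Gamma0) z ->
  op_adjoint (gamma_field T Gamma0 z) (h, k) ->
  op_adjoint (gamma_field T Gamma0 z) (h, k') -> k = k'.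
Proof.
move=> zA hk hk'; apply: dense_ran_Gamma0 => f x fx.
have [g xg] := dom_gamma_field zA fx.
by rewrite -(hk _ _ xg) -(hk' _ _ xg).
Qed.

Lemma linear_gamma_field z : resolvent_set (A_0 T Gamma0) z ->
  linear_op (gamma_field T Gamma0 z).
Proof.
move=> zA; split.
- by apply/gamma_fieldE; rewrite scaler0; case: (linG0) (linT) => ? _ _ [].
- move=> a u f u' f' /gamma_fieldE[fu Tf] /gamma_fieldE[fu' Tf'];
  apply/gamma_fieldE; split.
    exact: linear_op_combination.
  by have := linear_op_combination a linT Tf Tf';
    rewrite scalerDr !scalerA [z * a]mulrC.
- by move=> u f f'; exact: gamma_field_uniq.
Qed.

(** M(z) is contained in the adjoint of M(conj z), which is closed and, as ran Gamma0 is dense,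
    single-valued. *)
Lemma weyl_closure_uniq z x y y' : resolvent_set (A_0 T Gamma0) z ->
  closure (weyl T Gamma0 Gamma1 z) (x, y) ->
  weyl T Gamma0 Gamma1 z (x, y') -> y = y'.
Proof.
move=> zA cl xy'; have zA' := A_0_resolvent_conj zA.
have sub : weyl T Gamma0 Gamma1 z `<=`
    op_adjoint (weyl T Gamma0 Gamma1 (Num.conj z)).
  move=> [a b] /weylE[f [fa Tf fb]] a' b' /weylE[g [ga Tg gb]].
  have := green Tg ga gb Tf fa fb.
  by rewrite innerZl innerZr subrr => /esym/subr0_eq.
have linw := linear_op_mul linG1 (linear_gamma_field zA').
have /closure_subset := sub; move=> /(_ _ cl).
rewrite -(closure_id _).1 => [h|]; last exact: closed_adjoint.
apply: dense_ran_Gamma0 => f u fu.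
have [g ug] := dom_gamma_field zA' fu.
have /gamma_fieldE[_ Tg] := ug; have [v gv] := Gamma1_ex Tg.
have uv : weyl T Gamma0 Gamma1 (Num.conj z) (u, v) by exists g.
by rewrite -(h _ _ uv) /= -(sub _ xy' _ _ uv).
Qed.

(** The closed graph theorem applies: the operator is everywhere defined and lies in the adjoint of
    gamma(conj z), which is closed and single-valued. *)
Lemma Gamma1_resolvent_bounded z : resolvent_set (A_0 T Gamma0) z ->
  bounded_op (op_mul Gamma1 (resolvent (A_0 T Gamma0) z)).
Proof.
move=> zA; apply/bounded_opP; have zA' := A_0_resolvent_conj zA.
have linP : linear_op (op_mul Gamma1 (resolvent (A_0 T Gamma0) z)).
  by apply: linear_op_mul => //; case: zA.
apply: closed_graph => //.
  apply/seteqP; split=> // h _; have [u Au] := resolvent_set_ex h zA.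
  have [Tu _] := Au; have [k uk] := Gamma1_ex Tu.
  by exists k, u => //; apply/resolventE.
move=> k cl; apply: dense_ran_Gamma0 => f x fx.
have [g xg] := dom_gamma_field zA' fx.
suff /(_ _ cl) h : closure (op_mul Gamma1 (resolvent (A_0 T Gamma0) z)) `<=`
    op_adjoint (gamma_field T Gamma0 (Num.conj z)).
  by rewrite inner0r -(h _ _ xg) inner0r.
rewrite [X in _ `<=` X](closure_id _).1.
  by apply: closure_subset => -[h l]; exact: gamma_field_adjoint.
exact/closed_adjoint/linear_gamma_field.
Qed.

(** For f = gamma(z) x and k = Gamma1 (A_0 - conj z)^-1 f one has |f|^2 = (x, k) and |k| <= c
    |f|. *)
Lemma gamma_field_bounded z : resolvent_set (A_0 T Gamma0) z ->
  bounded_op (gamma_field T Gamma0 z).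
Proof.
move=> /A_0_resolvent_conj zA.
have /bounded_opP[c c0 hc] := Gamma1_resolvent_bounded zA.
apply/bounded_opP; exists c => // x f xf.
have [u Au] := resolvent_set_ex f zA; have [Tu _] := Au.
have [k uk] := Gamma1_ex Tu.
have fk : op_mul Gamma1 (resolvent (A_0 T Gamma0) (Num.conj z)) (f, k).
  by exists u => //; apply/resolventE.
have := gamma_field_adjoint fk; rewrite conjCK => /(_ _ _ xf) /= e.
have [->|f0] := eqVneq (nrm f) 0; first by rewrite mulr_ge0 ?nrm_ge0.
have f1 : 0 < nrm f by rewrite lt_def f0 nrm_ge0.
rewrite -(ler_pM2l f1) -expr2 -rip_nrm /rip e -/(rip x k).
apply: le_trans (rip_le _ _) _;
  apply: le_trans (ler_wpM2l (nrm_ge0 x) (hc _ _ fk)) _.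
lra.
Qed.

End QuasiBoundaryTripleTheory.

(** * The operators A_[B] *)

Lemma closed_resolvent_set (R : realType) (H : hilbertType R) (A :
  set (H * H)) (z : R[i]) :
  linear_op A -> resolvent_set A z -> closed A.
Proof.
move=> linA zA [f g] /closure_pairP cl.
have [f' Af'] := resolvent_set_ex (g - z *: f) zA.
suff ff' : f = f' by move: Af'; rewrite -ff' subrK.
have [_ _ /bounded_opP[c c0 hc]] := zA.
set d := complex.Re `|z|.
apply/subr0_eq/nrm_eq0/eqP; rewrite eq_le nrm_ge0 andbT.
(* For a graph point (f1, g1) within t = 2^-n of (f, g), the 1 bounds f - f1, while (1 + d) t bounds
   (g1 - g) - z (f1 - f), which the resolvent maps to f1 - f'. *)
apply: (@le_half_pow _ (1 + c * (1 + d))) => n; rewrite add0r.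
have e0 : 0 < (2 ^+ n)^-1 :> R by rewrite invr_gt0 exprn_gt0.
have [[f1 g1] /= [A1 h1 h2]] := cl _ e0.
have /hc bnd : resolvent A z ((g1 - g) - z *: (f1 - f), f1 - f').
  apply/resolventE; have := linear_opB linA A1 Af'.
  congr (A (_, _)).
  rewrite -[RHS]addrA [- (z *: _) + _]addrC -scalerBr opprB [_ + (f - f1)]addrC
    addrA.
  by rewrite subrK scalerBr opprD opprB [z *: f - g]addrC !addrA.
have := nrm_sub_trans f1 f f'; have := nrmD (g1 - g) (- (z *: (f1 - f))).
rewrite nrmN nrmZ -/d => h3 h4.
have d0 : 0 <= d by have := normr_ge0 z; rewrite lecE => /andP[].
rewrite nrmBC in h2; have h5 := h1; rewrite nrmBC in h5.
have := ler_wpM2l d0 (ltW h5).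
move: (_^-1) e0 h1 h2 {h5} => t e0 h1 h2 h5.
have : nrm (g1 - g - z *: (f1 - f)) <= t + d * t by lra.
move=> /(ler_wpM2l c0); lra.
Qed.

(** * The resolvent of A_[B] and Krein's formula *)

Section KreinFormula.
Context {R : realType} {H G : hilbertType R}.
Variables (S T : set (H * H)) (Gamma0 Gamma1 : set (H * G)).
Hypothesis qbt : quasi_boundary_triple T Gamma0 Gamma1 S.
Variables (B : set (G * G)) (z : R[i]).
Hypothesis linB : linear_op B.
Hypothesis zA0 : resolvent_set (A_0 T Gamma0) z.

Let linT : linear_op T. Proof. by case: qbt => [[]]. Qed.
Let linG0 : linear_op Gamma0. Proof. by case: qbt => _ []. Qed.
Let linG1 : linear_op Gamma1. Proof. by case: qbt => _ []. Qed.

(** For f in ker (A_[B] - z), y = Gamma0 f is a fixed point of B M(z), so (i) gives y = 0 and f lies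
    in ker (A_0 - z). *)
Lemma A_B_inj f : boundary_conditions T Gamma0 Gamma1 B z ->
  A_B T Gamma0 Gamma1 B (f, z *: f) -> f = 0.
Proof.
move=> [[linBM _ _] _ _ _] [/= Tf [x [y [fx xy fy]]]].
apply: (Gamma0_inj zA0) => //; suff <- : y = 0 by [].
apply: (resolvent_inj linBM); rewrite scale1r; exists x => //.
by apply: subset_closure; apply/weylE; exists f.
Qed.

Lemma B_ran_Gamma1 f k b : boundary_conditions T Gamma0 Gamma1 B z ->
  Gamma1 (f, k) -> B (k, b) -> op_ran Gamma0 b.
Proof.
move=> [_ BM _ [h|zA1]] fk kb; first by apply: h; exists k => //; exists f.
have [Tf fTf] : op_dom T f by case: qbt => _ [_ _ _ <-] _ _ _; exists k.
(* When z is in rho(A_1), subtracting u in ker Gamma1 moves f into ker (T - z) without changing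
   Gamma1 f = k. So k lies in ran M(z), and (ii) applies. *)
have [u /= [Tu u0]] := resolvent_set_ex (Tf - z *: f) zA1.
apply: BM; exists k => //; split; last by exists b.
have gk : Gamma1 (f - u, k) by have := linear_opB linG1 fk u0; rewrite subr0.
have Tg : T (f - u, z *: (f - u)).
  by have := linear_opB linT fTf Tu;
    rewrite opprD opprB addrA [Tf + _]addrC subrK scalerBr.
have [x gx] := Gamma0_ex qbt Tg.
by exists x; apply: subset_closure; apply/weylE; exists (f - u).
Qed.

(* x solves (I - B M(z)) x = b; the resolvent at 1 is (B M(z) - I)^-1, whence
   the sign of b. *)
Lemma A_B_solve h u k b x : boundary_conditions T Gamma0 Gamma1 B z ->
  resolvent (A_0 T Gamma0) z (h, u) -> Gamma1 (u, k) -> B (k, b) ->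
  resolvent (op_mul B (closure (weyl T Gamma0 Gamma1 z))) 1 (- b, x) ->
  exists2 f, gamma_field T Gamma0 z (x, f)
    & resolvent (A_B T Gamma0 Gamma1 B) z (h, u + f).
Proof.
move=> cond /resolventE[/= Tu u0] uk kb /resolventE[y /= cly].
rewrite scale1r => By.
have [g gb] := B_ran_Gamma1 cond uk kb.
have [_ BM _ _] := cond.
(* B y = x - b and b both lie in ran Gamma0, hence so does x. *)
have [g' g'x] : op_ran Gamma0 (- b + x).
  by apply: BM; exists y => //; split; [exists x | exists (- b + x)].
have [f xf] : exists f, gamma_field T Gamma0 z (x, f).
  apply: (dom_gamma_field qbt zA0 (f := g + g')).
  by have := linear_opD linG0 gb g'x; rewrite addNKr.
exists f => //; apply/resolventE.
have /gamma_fieldE[fx Tf] := xf; have [y' fy'] := Gamma1_ex qbt Tf.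
have yy' : y = y' by apply: (weyl_closure_uniq qbt zA0 cly); apply/weylE;
  exists f.
rewrite {}yy' in By.
split=> /=.
  by have := linear_opD linT Tu Tf; rewrite scalerDr addrA.
exists (k + y'), (b + (- b + x)); split.
- exact: linear_opD.
- exact: linear_opD.
- by have := linear_opD linG0 u0 fx; rewrite add0r addNKr.
Qed.

Lemma A_B_surj : boundary_conditions T Gamma0 Gamma1 B z ->
  op_dom (resolvent (A_B T Gamma0 Gamma1 B) z) = setT.
Proof.
move=> cond; apply/seteqP; split=> // h _.
have [[_ domBM _] _ domB _] := cond.
have [u Au] := resolvent_set_ex h zA0; have [Tu _] := Au.
have [k uk] := Gamma1_ex qbt Tu.
have [b kb] : op_dom B k by apply: domB; exists u.
have [x bx] : op_dom (resolvent (op_mul B (closure (weyl T Gamma0 Gamma1 z)))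
  1) (- b).
  by rewrite domBM.
have [|f _ uf] := A_B_solve (h := h) cond _ uk kb bx; first exact/resolventE.
by exists (u + f).
Qed.

Lemma B_Gamma1_resolvent_bounded : closable_op B -> op_ran Gamma1 `<=` op_dom B ->
  bounded_op (op_mul B (op_mul Gamma1 (resolvent (A_0 T Gamma0) z))).
Proof.
move=> [_ [cB0 _ cBf]] domB; apply/bounded_opP.
have /bounded_opP[c c0 hc] := Gamma1_resolvent_bounded qbt zA0.
apply: closed_graph.
- by do 2! [apply: linear_op_mul => //]; case: zA0.
- apply/seteqP; split=> // h _.
  have [u Au] := resolvent_set_ex h zA0; have [Tu _] := Au.
  have [k uk] := Gamma1_ex qbt Tu.
  have [b kb] : op_dom B k by apply: domB; exists u.
  by exists b, k => //; exists u => //; apply/resolventE.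
- move=> b /closure_pairP cl; apply: cBf _ cB0; apply/closure_pairP => e e0.
  (* With this tolerance on h, the bound c of Gamma1 (A_0 - z)^-1 gives |k| < e; thus (0, b) is in
     the closure of B. Adding 1 covers c = 0 and keeps the tolerance at most e. *)
  have d0 : 0 < e / (c + 1) by rewrite divr_gt0 // ltr_wpDl.
  have [[h b'] /= [[k hk kb'] hh hb]] := cl _ d0.
  exists (k, b'); split=> //=.
    rewrite sub0r nrmN; apply: le_lt_trans (hc _ _ hk) _.
    rewrite sub0r nrmN ltr_pdivlMr ?ltr_wpDl // in hh.
    by have := nrm_ge0 h; lra.
  apply: lt_le_trans hb _; rewrite ler_pdivrMr ?ltr_wpDl //.
  by have := mulr_ge0 (ltW e0) c0; lra.
Qed.

Lemma A_B_resolvent_set : closable_op B ->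
  boundary_conditions T Gamma0 Gamma1 B z ->
  resolvent_set (A_B T Gamma0 Gamma1 B) z.
Proof.
move=> closB cond; have linAB := linear_A_B qbt linB.
have linr : linear_op (resolvent (A_B T Gamma0 Gamma1 B) z).
  by apply: linear_resolvent => // f; exact: A_B_inj.
split=> //; first exact: A_B_surj.
have [[_ domBM /bounded_opP[c3 c30 hc3]] _ domB _] := cond.
have /bounded_opP[c2 c20 hc2] := gamma_field_bounded qbt zA0.
have /bounded_opP[c4 c40 hc4] := B_Gamma1_resolvent_bounded closB domB.
have [_ _ /bounded_opP[c1 c10 hc1]] := zA0.
(* One constant for each factor of Krein's formula: (A_0 - z)^-1, gamma(z), the resolvent of B times
   the closure of M(z) at 1, and B Gamma1 (A_0 - z)^-1. *)
apply/bounded_opP; exists (c1 + c2 * (c3 * c4)) => [|h g hg].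
  by rewrite addr_ge0 // mulr_ge0 // mulr_ge0.
have [u /resolventE hu] := resolvent_set_ex h zA0; have /resolventE[Tu _] := hu.
have [k uk] := Gamma1_ex qbt Tu.
have [b kb] : op_dom B k by apply: domB; exists u.
have [x bx] : op_dom (resolvent (op_mul B (closure (weyl T Gamma0 Gamma1 z)))
  1) (- b).
  by rewrite domBM.
have [f xf huf] := A_B_solve cond hu uk kb bx.
have -> : g = u + f by case: linr => _ _ /(_ _ _ _ hg huf).
apply: le_trans (nrmD _ _) _; rewrite mulrDl; apply: lerD; first exact: hc1.
have /hc4 h4 : op_mul B (op_mul Gamma1 (resolvent (A_0 T Gamma0) z)) (h, b).
  by exists k => //; exists u.
apply: le_trans (hc2 _ _ xf) _; rewrite -mulrA ler_wpM2l //.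
apply: le_trans (hc3 _ _ bx) _; rewrite nrmN -mulrA ler_wpM2l //.
Qed.

(** Krein's formula is claimed at all points of both resolvent sets, whereas (i) concerns lambda0
    only. Here injectivity of I - B M(z) comes from ker (A_[B] - z) = 0: x is Gamma0 f for some f in
    that kernel. *)
Lemma weyl_fixpoint_eq0 x : resolvent_set (A_B T Gamma0 Gamma1 B) z ->
  op_mul B (weyl T Gamma0 Gamma1 z) (x, x) -> x = 0.
Proof.
move=> [linr _ _] [y /weylE[f [fx Tf fy]] yx].
have f0 : f = 0 by apply: (resolvent_inj linr); split=> //; exists y, x.
rewrite f0 in fx; case: linG0 => G00 _ Gf; exact: Gf fx G00.
Qed.

Lemma linear_inv_I_BM : resolvent_set (A_B T Gamma0 Gamma1 B) z ->
  linear_op (op_inv (op_sub (op_scalar 1) (op_mul B (weyl T Gamma0 Gamma1 z)))).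
Proof.
move=> zAB.
have linBM : linear_op (op_mul B (weyl T Gamma0 Gamma1 z)).
  do 2! [apply: linear_op_mul => //]; exact: (linear_gamma_field qbt zA0).
have subE y x : op_inv (op_sub (op_scalar 1) (op_mul B (weyl T Gamma0 Gamma1
  z))) (y, x) <->
    op_mul B (weyl T Gamma0 Gamma1 z) (x, x - y).
  split=> [[p [q [/= + BMq]]]|BM].
    by rewrite /op_scalar /= scale1r => -> ->; rewrite opprB addrC subrK.
  by exists x, (x - y); split=> //=;
    rewrite /op_scalar /= ?scale1r // opprB addrC subrK.
split.
- by apply/subE; rewrite subr0; case: linBM.
- move=> a y x y' x' /subE BM /subE BM'; apply/subE.
  have := linear_op_combination a linBM BM BM'.
  by rewrite scalerBr addrACA opprD.
- move=> y x x' /subE BM /subE BM'; apply/subr0_eq/weyl_fixpoint_eq0 => //.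
  by have := linear_opB linBM BM BM'; rewrite opprB addrA subrK.
Qed.

Lemma krein_formula : op_ran Gamma1 `<=` op_dom B ->
  resolvent_set (A_B T Gamma0 Gamma1 B) z ->
  resolvent (A_B T Gamma0 Gamma1 B) z =
    op_add (resolvent (A_0 T Gamma0) z)
      (op_mul (gamma_field T Gamma0 z)
        (op_mul (op_inv (op_sub (op_scalar 1) (op_mul B (weyl T Gamma0 Gamma1
          z))))
          (op_mul B (op_adjoint (gamma_field T Gamma0 (Num.conj z)))))).
Proof.
move=> domB zAB; set rhs := op_add _ _.
(* Split f = u + gamma(z) x with u = (A_0 - z)^-1 h and x = Gamma0 f. Then M(z) x = v - k, so B M(z)
   x = x - b. *)
have sub : resolvent (A_B T Gamma0 Gamma1 B) z `<=` rhs.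
  move=> [h f] /resolventE[/= Tf [v [x [fv vx fx]]]].
  have [u /resolventE hu] := resolvent_set_ex h zA0.
  have xf := gamma_field_sub_resolvent qbt Tf fx hu.
  have /resolventE[Tu u0] := hu; have [k uk] := Gamma1_ex qbt Tu.
  have [b kb] : op_dom B k by apply: domB; exists u.
  exists u, (f - u); split=> //=; last by rewrite addrC subrK.
  exists x => //; exists b.
    exists k => //; apply: (gamma_field_adjoint qbt).
    by exists u.
  exists x, (x - b); split=> /=; rewrite ?/op_scalar /= ?scale1r ?opprB //;
    last by rewrite addrC subrK.
  have /gamma_fieldE[gx Tg] := xf.
  exists (v - k); last exact: linear_opB.
  by apply/weylE; exists (f - u); split=> //; exact: linear_opB.
(* Equality follows from the inclusion, since the left side is everywhere defined and every factor
   on the right is single-valued. *)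
apply/seteqP; split=> // -[h f] hf.
have [f' /resolventE hf'] := resolvent_set_ex h zAB.
suff -> : f = f' by [].
have [u [g [/= hu [x [b [k hk kb] bx] xg] ->]]] := hf.
have [u' [g' [/= hu' [x' [b' [k' hk' kb'] bx'] xg'] ->]]] := sub _ hf'.
have zA0' := A_0_resolvent_conj qbt zA0.
have kk' := gamma_field_adjoint_uniq qbt zA0' hk hk'; rewrite -kk' in kb'.
have bb' : b = b' by case: linB => _ _ Bf; exact: Bf kb kb'.
rewrite -bb' in bx'.
have xx' : x = x' by case: (linear_inv_I_BM zAB) => _ _ If; exact: If bx bx'.
rewrite -xx' in xg'.
have -> : g = g' := gamma_field_uniq qbt zA0 xg xg'.
by congr (_ + _); case: zA0 => -[_ _ rf] _ _; exact: rf hu hu'.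
Qed.

End KreinFormula.

(** * The adjoint of A_[B] *)

Section Duality.
Context {R : realType} {H G : hilbertType R}.
Variables (S T : set (H * H)) (Gamma0 Gamma1 : set (H * G)).
Hypothesis qbt : quasi_boundary_triple T Gamma0 Gamma1 S.
Variables (B B' : set (G * G)).
Hypothesis BB' : forall x Bx y B'y,
  B (x, Bx) -> B' (y, B'y) -> inner Bx y = inner x B'y.

(** The boundary term (Gamma1 f, B' Gamma1 g) - (B Gamma1 f, Gamma1 g) of Green's identity vanishes
    by [BB']. *)
Lemma A_B_sub_adjoint :
  A_B T Gamma0 Gamma1 B' `<=` op_adjoint (A_B T Gamma0 Gamma1 B).
Proof.
move=> [g Tg] [/= TTg [x' [y' [gx xy' gy]]]] f Tf [/= TTf [x [y [fx xy fy]]]].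
apply/subr0_eq; rewrite (green qbt TTf fy fx TTg gy gx).
by rewrite (BB' xy xy') subrr.
Qed.

Lemma A_B_eq_adjoint (z : R[i]) :
  resolvent_set (A_B T Gamma0 Gamma1 B) z ->
  op_dom (resolvent (A_B T Gamma0 Gamma1 B') (Num.conj z)) = setT ->
  A_B T Gamma0 Gamma1 B' = op_adjoint (A_B T Gamma0 Gamma1 B).
Proof.
move=> zA dom'; apply/seteqP; split; first exact: A_B_sub_adjoint.
move=> [f g] adj.
have [u /resolventE Au] : op_dom (resolvent (A_B T Gamma0 Gamma1 B') (Num.conj z))
    (g - Num.conj z *: f) by rewrite dom'.
suff fu : f = u by move: Au; rewrite -fu subrK.
(* f - u is in the kernel of the adjoint minus conj z, hence orthogonal to ran (A_[B] - z); v shows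
   that f - u belongs to that range. *)
have [v Av] := resolvent_set_ex (f - u) zA.
have := A_B_sub_adjoint Au Av; have := adj _ _ Av => /= e1 e2.
apply/subr0_eq/nrm_eq0/eqP; rewrite -sqrf_eq0 -rip_nrm /rip.
suff -> : inner (f - u) (f - u) = 0 by [].
have := congr2 (fun a b => a - b) e1 e2.
rewrite -!innerBr opprD opprB !addrA.
rewrite [inner (_ + z *: v) _]innerDl innerZl.
have -> : g + Num.conj z *: f - g - Num.conj z *: u = Num.conj z *: (f - u).
  by rewrite [g + _]addrC addrK scalerBr.
by rewrite innerZr conjCK -[RHS]add0r => /addIr.
Qed.

End Duality.

Theorem theorem4p1 (R : realType) (H G : hilbertType R)
    (S T : set (H * H)) (Gamma0 Gamma1 : set (H * G))
    (S_closed : closed_op S) (S_dense : dense (op_dom S))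
    (S_sym : symmetric_op S)
    (qbt : quasi_boundary_triple T Gamma0 Gamma1 S)
    (B : set (G * G)) (B_closable : closable_op B)
    (lambda0 : R[i])
    (lambda0_A0 : resolvent_set (A_0 T Gamma0) lambda0)
    (B_cond : boundary_conditions T Gamma0 Gamma1 B lambda0) :
  [/\ closed_op (A_B T Gamma0 Gamma1 B),
      S `<=` A_B T Gamma0 Gamma1 B,
      resolvent_set (A_B T Gamma0 Gamma1 B) lambda0
    & forall lambda : R[i],
        resolvent_set (A_B T Gamma0 Gamma1 B) lambda ->
        resolvent_set (A_0 T Gamma0) lambda ->
        let I_BM :=
          op_sub (op_scalar 1) (op_mul B (weyl T Gamma0 Gamma1 lambda)) in
        linear_op (op_inv I_BM) /\
        resolvent (A_B T Gamma0 Gamma1 B) lambda =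
          op_add (resolvent (A_0 T Gamma0) lambda)
            (op_mul (gamma_field T Gamma0 lambda)
              (op_mul (op_inv I_BM)
                (op_mul B
                  (op_adjoint (gamma_field T Gamma0 (Num.conj lambda))))))]
  /\ (forall B' : set (G * G),
        linear_op B' ->
        boundary_conditions T Gamma0 Gamma1 B' (Num.conj lambda0) ->
        (forall x Bx y B'y,
          B (x, Bx) -> B' (y, B'y) -> inner Bx y = inner x B'y) ->
        [/\ closed_op (A_B T Gamma0 Gamma1 B'),
            A_B T Gamma0 Gamma1 B' = op_adjoint (A_B T Gamma0 Gamma1 B)
          & resolvent_set (A_B T Gamma0 Gamma1 B') (Num.conj lambda0)]).
Proof.
have linB := B_closable.1; have [_ _ domB _] := B_cond.
have l0AB := A_B_resolvent_set qbt linB lambda0_A0 B_closable B_cond.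
split.
  split=> //.
  - have linAB := linear_A_B qbt linB.
    by split=> //; exact: closed_resolvent_set l0AB.
  - exact: (extension_A_B qbt linB).
  - move=> l lAB lA0 /=; split; first exact: (linear_inv_I_BM qbt linB lA0 lAB).
    exact: (krein_formula qbt linB lA0 domB lAB).
move=> B' linB' cond' BB'.
have linAB' := linear_A_B qbt linB'.
have domAB' := A_B_surj qbt linB' (A_0_resolvent_conj qbt lambda0_A0) cond'.
have l0AB' := resolvent_set_adjoint linAB' (A_B_sub_adjoint qbt BB') l0AB domAB'.
split=> //; first by split=> //; exact: closed_resolvent_set l0AB'.
exact: (A_B_eq_adjoint qbt BB' l0AB domAB').
Qed.
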